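(* For every integer $n\ge 2^{100}$ there is an unweighted connected graph $G$ with $n$ nodes such that the following holds for every $\epsilon\in(5n^{-0.1},1/2)$. Let $t=\lfloor 0.05\,\epsilon^{-2}\log n\rfloor$ and let $T_1,\ldots,T_t$ be $t$ independent inverse leverage score weighted random spanning trees of $G$. Then with probability at least $1-e^{-n^{0.39}}$, both $$(1-\epsilon)L_G\not\prec\frac1t\sum_{i=1}^tL_{T_i}\qquad\text{and}\qquad \frac1t\sum_{i=1}^tL_{T_i}\not\prec(1+\epsilon)L_G .$$
   Context: Logarithms are base $2$. Let $G=(V,E)$ be a connected unweighted undirected graph (all edge weights equal $1$). For an edge $e=(u,v)$ let $b_e\in\mathbb{R}^V$ have entry $1$ at $u$, $-1$ at $v$, and $0$ elsewhere. The Laplacian is $L_G=\sum_{e\in E} b_eb_e^\top$, and $L_G^\dagger$ is its Moore-Penrose pseudoinverse. The leverage score of $e$ is $l_e=b_e^\top L_G^\dagger b_e$. An inverse leverage score weighted random spanning tree $T$ is a uniformly random spanning tree of $G$ in which each edge $e\in T$ is given weight $1/l_e$; its Laplacian is $L_T=\sum_{e\in T}\frac{1}{l_e}b_eb_e^\top$. For Laplacians $A,B$ on the vertex set $V$, $A\prec B$ means $x^\top A x<x^\top Bx$ for every nonzero $x\in\mathbb{R}^V$ orthogonal to the all-ones vector; $A\not\prec B$ is the negation, i.e. there is a nonzero $x$ orthogonal to the all-ones vector with $x^\top Ax\ge x^\top Bx$. *)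

(* Defs.v *)
From mathcomp Require Import all_boot all_order all_algebra.
From mathcomp Require Import all_classical all_reals all_analysis.

Set Implicit Arguments.
Unset Strict Implicit.
Unset Printing Implicit Defensive.

Import Order.TTheory GRing.Theory Num.Theory.

Local Open Scope classical_set_scope.
Local Open Scope ring_scope.

Section PseudoInverse.
Variable R : realType.

(* The four Penrose conditions; the conjugate transpose is the transpose since
   the scalars are real. *)
Definition is_mp_inverse m n (A : 'M[R]_(m, n)) (B : 'M[R]_(n, m)) : Prop :=
  [/\ A *m B *m A = A, B *m A *m B = B,
      (A *m B)^T = A *m B & (B *m A)^T = B *m A].

(* The default value 0 is never used: see mp_inverseP and is_mp_inverse_uniq. *)
Definition mp_inverse m n (A : 'M[R]_(m, n)) : 'M[R]_(n, m) :=
  xget 0 [set B | is_mp_inverse A B].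

Lemma gram_unitmx m n (F : 'M[R]_(m, n)) : row_free F -> F *m F^T \in unitmx.
Proof.
move=> Ffree; rewrite -row_free_unit -kermx_eq0.
apply/rowV0P => u /sub_kermxP uFF.
have uF0 : u *m F = 0.
  apply/rowP => j; rewrite [RHS]mxE; apply/eqP.
  have /(congr1 (fun M : 'M[R]_1 => M 0 0)) : (u *m F) *m (u *m F)^T = 0.
    by rewrite trmx_mul mulmxA -(mulmxA u) uFF mul0mx.
  rewrite [LHS]mxE [RHS]mxE => /eqP; rewrite psumr_eq0; last first.
    by move=> i _; rewrite [X in _ * X]mxE -expr2 sqr_ge0.
  by move=> /allP/(_ j (mem_index_enum j)); rewrite [X in _ * X]mxE -expr2 sqrf_eq0.
by apply: (row_free_inj Ffree); rewrite mul0mx.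
Qed.

Lemma is_mp_inverse_ex m n (A : 'M[R]_(m, n)) : exists B, is_mp_inverse A B.
Proof.
move: (mulmx_base A) (row_base_free A) (col_base_full A).
move: (\rank A) (col_base A) (row_base A) => r C F <- Ffree Cfull.
have UF : F *m F^T \in unitmx by exact: gram_unitmx.
have UC : C^T *m C \in unitmx.
  by rewrite -{2}[C]trmxK; apply: gram_unitmx; rewrite /row_free mxrank_tr.
set GF := invmx (F *m F^T); set GC := invmx (C^T *m C).
have tGF : GF^T = GF by rewrite /GF trmx_inv trmx_mul trmxK.
have tGC : GC^T = GC by rewrite /GC trmx_inv trmx_mul trmxK.
have FG : F *m (F^T *m GF) = 1%:M by rewrite mulmxA mulmxV.
have GCC : GC *m C^T *m C = 1%:M by rewrite -mulmxA mulVmx.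
pose B := (F^T *m GF) *m (GC *m C^T).
have ABE : C *m F *m B = C *m (GC *m C^T).
  by rewrite /B mulmxA -(mulmxA C) FG mulmx1.
have BAE : B *m (C *m F) = F^T *m GF *m F.
  by rewrite /B mulmxA -(mulmxA (F^T *m GF)) GCC mulmx1.
exists B; split.
- by rewrite ABE mulmxA -(mulmxA C) GCC mulmx1.
- by rewrite BAE /B mulmxA -(mulmxA (F^T *m GF)) FG mulmx1.
- by rewrite ABE !trmx_mul trmxK tGC mulmxA.
- by rewrite BAE !trmx_mul trmxK tGF mulmxA.
Qed.

Lemma mp_inverseP m n (A : 'M[R]_(m, n)) : is_mp_inverse A (mp_inverse A).
Proof. exact: (xgetPex 0 (is_mp_inverse_ex A)). Qed.

Lemma is_mp_inverse_uniq m n (A : 'M[R]_(m, n)) B B' :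
  is_mp_inverse A B -> is_mp_inverse A B' -> B = B'.
Proof.
move=> [ABA BAB tAB tBA] [AB'A B'AB' tAB' tB'A].
have E1 : A *m B = A *m B'.
  by rewrite -{1}AB'A -mulmxA -tAB' -tAB -trmx_mul mulmxA ABA tAB'.
have E2 : B *m A = B' *m A.
  by rewrite -{1}AB'A mulmxA mulmxA -(mulmxA (B *m A)) -tBA -tB'A -trmx_mul
     -mulmxA (mulmxA A) ABA tB'A.
by rewrite -BAB E2 -mulmxA E1 mulmxA B'AB'.
Qed.

End PseudoInverse.

Section Graphs.
Variable n : nat.

Record sgraph := SGraph {
  adj : rel 'I_n;
  adj_sym : symmetric adj;
  adj_irr : irreflexive adj
}.

(* An undirected edge {u, v} is represented by the pair (u, v) with u < v. *)
Definition edges (G : sgraph) : {set 'I_n * 'I_n} :=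
  [set e : 'I_n * 'I_n | (e.1 < e.2)%N && adj G e.1 e.2]%SET.

Definition edge_rel (S : {set 'I_n * 'I_n}) : rel 'I_n :=
  [rel u v | ((u, v) \in S) || ((v, u) \in S)].

Definition rel_connected (r : rel 'I_n) : Prop := forall u v, connect r u v.

(* For a symmetric r, a ucycle with two vertices just traverses an edge back
   and forth, so a cycle of the graph is a ucycle with at least three. *)
Definition rel_acyclic (r : rel 'I_n) : Prop :=
  forall c : seq 'I_n, ucycle r c -> (size c < 3)%N.

Definition spanning_tree (G : sgraph) (T : {set 'I_n * 'I_n}) : Prop :=
  [/\ T \subset edges G, rel_connected (edge_rel T) & rel_acyclic (edge_rel T)].

Definition spanning_trees (G : sgraph) : {set {set 'I_n * 'I_n}} :=
  [set T | `[< spanning_tree G T >]]%SET.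

End Graphs.

Section Laplacians.
Variables (R : realType) (n : nat).

Definition edge_vec (e : 'I_n * 'I_n) : 'cV[R]_n :=
  \col_i ((i == e.1)%:R - (i == e.2)%:R).

Definition laplacian (G : sgraph n) : 'M[R]_n :=
  \sum_(e in edges G) edge_vec e *m (edge_vec e)^T.

Definition leverage (G : sgraph n) (e : 'I_n * 'I_n) : R :=
  ((edge_vec e)^T *m mp_inverse (laplacian G) *m edge_vec e) 0 0.

(* Laplacian of the edge set T with the inverse leverage score weights. *)
Definition tree_laplacian (G : sgraph n) (T : {set 'I_n * 'I_n}) : 'M[R]_n :=
  \sum_(e in T) (leverage G e)^-1 *: (edge_vec e *m (edge_vec e)^T).

Definition lap_lt (A B : 'M[R]_n) : Prop :=
  forall x : 'cV[R]_n, x != 0 -> \sum_i x i 0 = 0 ->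
    (x^T *m A *m x) 0 0 < (x^T *m B *m x) 0 0.

End Laplacians.

Arguments edge_vec R {n} e.
Arguments laplacian R {n} G.
Arguments leverage R {n} G e.
Arguments tree_laplacian R {n} G T.

Section Probability.
Context {R : realType} {d : measure_display} {Omega : measurableType d}.
Variable P : probability Omega R.

(* The finite type X carries the discrete sigma-algebra. *)
Definition finite_rv (X : finType) (f : Omega -> X) : Prop :=
  forall A : set X, measurable (f @^-1` A).

Definition mutually_independent (I X : finType) (f : I -> Omega -> X) : Prop :=
  forall (J : {set I}) (A : I -> set X),
    P (\bigcap_(i in [set` J]) (f i @^-1` A i)) =
    (\prod_(i in J) P (f i @^-1` A i))%E.

(* The weights 1 / l_e are a function of the tree, see tree_laplacian. *)
Definition uniform_spanning_tree n (G : sgraph n)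
    (T : Omega -> {set 'I_n * 'I_n}) : Prop :=
  finite_rv T /\
  forall S : {set 'I_n * 'I_n}, P (T @^-1` [set S]) =
    ((S \in spanning_trees G)%:R / #|spanning_trees G|%:R)%:E.

End Probability.

Definition log2 (R : realType) (x : R) : R := ln x / ln 2.

(* Main.v *)
Require Import Defs.
From mathcomp Require Import all_boot all_order all_algebra.
From mathcomp Require Import all_classical all_reals all_analysis.
From mathcomp Require Import zify ring lra.

Set Implicit Arguments.
Unset Strict Implicit.
Unset Printing Implicit Defensive.

Import Order.TTheory GRing.Theory Num.Theory.

Local Open Scope classical_set_scope.
Local Open Scope ring_scope.

(* Take the windmill graph: about n / 2 triangles (blades) glued along a common
   hub.  A uniform spanning tree drops one uniformly random edge in each blade,
   independently over the blades, and every blade edge has leverage score 2 / 3.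
   As soon as, in one blade {0, a, b}, at least t (1 / 3 + 4 eps / 3) of the trees
   drop the edge {a, b}, the vectors 1_a - 1_b and 1_a + 1_b witness that both
   spectral bounds fail.  For a fixed blade this is a binomial upper tail event,
   of probability at least n^(-0.59) by an entropy estimate; as the blades are
   independent, it fails in all of them with probability at most
   (1 - n^(-0.59))^((n - 1) / 2) <= exp (- n^0.39). *)

(** * Binomial tails *)

Lemma le_of_is_derive_ge0 (R : realType) (f df : R -> R) (a x : R) :
  (forall y, a <= y -> is_derive y 1 f (df y)) -> (forall y, a <= y -> 0 <= df y) ->
  a <= x -> f a <= f x.
Proof.
move=> fdf df0 ax; apply: (@ger0_derive1_ndecry _ f a) => //.
- by move=> y; rewrite in_itv /= andbT => /ltW /fdf [].
- by move=> y; rewrite in_itv /= andbT => /ltW ay;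
    rewrite derive1E; have [_ ->] := fdf _ ay; apply: df0.
- apply: derivable_within_continuous => y; rewrite in_itv /= andbT.
  by move=> /fdf [].
Qed.

(** The function [y ^+ 2 - 2 * y * ln y] has derivative [2 * (y - 1 - ln y) >= 0]. The resulting
    bound on [x * ln x] is exact to second order at 1. *)
Lemma ln_le_subV (R : realType) (x : R) : 1 <= x -> 2 * x * ln x <= x ^+ 2 - 1.
Proof.
move=> x1.
have := @le_of_is_derive_ge0 R (fun y => y * y - 2 * (y * ln y))
  (fun y => 2 * (y - 1 - ln y)) 1 x.
rewrite ln1 => H; suff : 1 * 1 - 2 * (1 * 0) <= x * x - 2 * (x * ln x) by lra.
apply: H => [y y1|y y1|//]; have y0 : 0 < y by lra.
- have dln := is_derive1_ln y0.
  apply: is_derive_eq => /=.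
  by rewrite /GRing.scale /=; field; lra.
- have := @le_ln1Dx R (y - 1); rewrite (_ : 1 + (y - 1) = y); [lra | ring].
Qed.

(** This is the Pade approximant [2 * (z - 1) / (z + 1)] of [ln] at 1. With the denominator cleared,
    the difference has derivative [ln y + y^-1 - 1], and [ln y^-1 <= y^-1 - 1]. *)
Lemma ln_ge_pade (R : realType) (z : R) : 1 <= z -> 2 * (z - 1) <= (z + 1) * ln z.
Proof.
move=> z1.
have := @le_of_is_derive_ge0 R (fun y => (y + 1) * ln y - 2 * y)
  (fun y => ln y + y^-1 - 1) 1 z.
rewrite ln1 => H; suff : (1 + 1) * 0 - 2 * 1 <= (z + 1) * ln z - 2 * z by lra.
apply: H => [y y1|y y1|//]; have y0 : 0 < y by lra.
- have dln := is_derive1_ln y0.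
  apply: is_derive_eq => /=.
  by rewrite /GRing.scale /=; field; lra.
- have yV0 : 0 < y^-1 by rewrite invr_gt0.
  have := @le_ln1Dx R (y^-1 - 1).
  by rewrite (_ : 1 + (y^-1 - 1) = y^-1); [rewrite lnV ?posrE //; lra | ring].
Qed.

Lemma ln2_ge (R : realType) : 137 / 200 <= ln 2 :> R.
Proof.
(* The Pade bound at 2 gives only 2/3; on the two factors it gives 2/7 + 2/5 = 24/35, just above
   137/200. *)
have -> : 2 = 4 / 3 * (3 / 2) :> R by field.
rewrite lnM ?posrE //; try lra.
have := @ln_ge_pade R (4 / 3); have := @ln_ge_pade R (3 / 2); lra.
Qed.

(* The mode of a binomial law of parameters t and m / t is m. *)
Lemma binomial_mode (t m k : nat) : (m <= t)%N -> (k <= t)%N ->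
  ('C(t, k) * m ^ k * (t - m) ^ (t - k) <= 'C(t, m) * m ^ m * (t - m) ^ (t - m))%N.
Proof.
move=> mt kt; set F := fun k => ('C(t, k) * m ^ k * (t - m) ^ (t - k))%N.
have ratio j : (j < t)%N -> (F j.+1 * (j.+1 * (t - m)) = F j * ((t - j) * m))%N.
  move=> jt; rewrite /F.
  have -> : (t - j = (t - j.+1).+1)%N by lia.
  rewrite expnSr expnS.
  have := mul_bin_left t j.
  have -> : (t - j = (t - j.+1).+1)%N by lia.
  move=> E.
  transitivity
    (j.+1 * 'C(t, j.+1) * m ^ j * m * (t - m) ^ (t - j.+1) * (t - m))%N.
    by ring.
  by rewrite E; ring.
change (F k <= F m)%N.
have [mt'|mt'] := ltnP m t; last first.
  have [kt'|kt'] := ltnP k t; last by rewrite (_ : m = k) //; lia.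
  rewrite /F (_ : m = t) ?subnn; last by lia.
  by rewrite exp0n ?muln0 //; lia.
have up j : (j < m)%N -> (F j <= F j.+1)%N.
  move=> jm; have := ratio j ltac:(lia).
  have pos : (0 < j.+1 * (t - m))%N by nia.
  have le : (j.+1 * (t - m) <= (t - j) * m)%N by nia.
  move=> E; rewrite -(leq_pmul2r pos) E leq_mul2l le orbT //.
have down j : (m <= j)%N -> (j < t)%N -> (F j.+1 <= F j)%N.
  move=> mj jt; have := ratio j jt.
  have pos : (0 < j.+1 * (t - m))%N by nia.
  have le : ((t - j) * m <= j.+1 * (t - m))%N by nia.
  move=> E; rewrite -(leq_pmul2r pos) E leq_mul2l le orbT //.
have [km|mk] := leqP k m.
  have : (forall i, i <= m -> F (m - i) <= F m)%N.
    elim=> [|i IH] im; first by rewrite subn0.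
    apply: leq_trans (IH _); last by lia.
    have -> : (m - i = (m - i.+1).+1)%N by lia.
    by apply: up; lia.
  by move=> /(_ (m - k)%N); rewrite subKn //; apply; lia.
have : (forall i, m + i <= t -> F (m + i) <= F m)%N.
  elim=> [|i IH] im; first by rewrite addn0.
  apply: leq_trans (IH _); last by lia.
  by rewrite addnS; apply: down; lia.
by move=> /(_ (k - m)%N); rewrite subnKC; [apply|lia].
Qed.

(** The binomial theorem expands [((t - m) + m) ^ t] into [t.+1] terms, none of which exceeds the
    one of index [m]. *)
Lemma binomial_type_bound (t m : nat) : (m <= t)%N ->
  (t ^ t <= t.+1 * ('C(t, m) * m ^ m * (t - m) ^ (t - m)))%N.
Proof.
move=> mt.
have {1}-> : (t = (t - m) + m)%N by rewrite subnK.
rewrite Pascal -[X in (_ <= X * _)%N]card_ord -sum_nat_const.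
apply: leq_sum => i _.
apply: leq_trans (binomial_mode mt (leq_ord i)); apply: eq_leq.
by ring.
Qed.

(** Apply [ln_ge_pade] to [y^-1]; after multiplication by [1 + y] the slack is
    [y * (1 - y) ^+ 3 / 2]. At [y = 0] both sides vanish. *)
Lemma xlnx_le (R : realType) (y : R) : 0 <= y <= 1 ->
  y * ln y <= - (1 - y) + (1 - y) ^+ 2 / 2 + (1 - y) ^+ 3 / 2.
Proof.
move=> /andP[]; rewrite le_eqVlt => /predU1P[<-|y0] y1.
  by rewrite mul0r subr0 !expr1n; lra.
have yV1 : 1 <= y^-1 by rewrite invf_ge1.
have := ln_ge_pade yV1; rewrite lnV ?posrE // => H.
have {}H : (1 + y) * ln y <= - 2 * (1 - y).
  have : y * (2 * (y^-1 - 1)) <= y * ((y^-1 + 1) * - ln y) by rewrite ler_pM2l.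
  have -> : y * (2 * (y^-1 - 1)) = 2 * (1 - y) by field; rewrite gt_eqF.
  have -> : y * ((y^-1 + 1) * - ln y) = - ((1 + y) * ln y).
    by field; rewrite gt_eqF.
  lra.
have y1p : 0 < 1 + y by lra.
rewrite -(ler_pM2l y1p).
apply: le_trans (_ : y * (- 2 * (1 - y)) <= _).
  by rewrite mulrCA ler_pM2l.
rewrite -subr_ge0.
have -> : (1 + y) * (- (1 - y) + (1 - y) ^+ 2 / 2 + (1 - y) ^+ 3 / 2) -
   y * (- 2 * (1 - y)) = y * (1 - y) ^+ 3 / 2 by field.
by rewrite mulr_ge0 ?invr_ge0 // mulr_ge0 ?exprn_ge0 //; lra.
Qed.

(* The exponent bounds t times the relative entropy of the Bernoulli laws of
   parameters m / t and 1 / 3. *)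
Lemma binomial_term_ge (R : realType) (t m : nat) (delta : R) :
  (0 < t)%N -> (m <= t)%N -> (t <= 3 * m)%N -> delta = m%:R / t%:R - 1 / 3 ->
  3 ^+ t <= t.+1%:R * ('C(t, m)%:R * 2 ^+ (t - m)) *
    expR (t%:R * (9 / 4 * delta ^+ 2 + 9 / 8 * delta ^+ 3)).
Proof.
move=> t0 mt t3m deltaE.
have t0R : 0 < t%:R :> R by rewrite ltr0n.
have m0 : (0 < m)%N by lia.
have m0R : 0 < m%:R :> R by rewrite ltr0n.
have mtR : m%:R <= t%:R :> R by rewrite ler_nat.
have t3mR : t%:R <= 3 * m%:R :> R by rewrite -natrM ler_nat.
(* These are the likelihood ratios of m/t to 1/3 and of 1 - m/t to 2/3, so [x ^+ m * y ^+ (t - m)]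
   is the exponential of [t] times the relative entropy. *)
pose x : R := 3 * m%:R / t%:R; pose y : R := 3 * (t - m)%:R / (2 * t%:R).
have x1 : 1 <= x by rewrite ler_pdivlMr ?mul1r.
have xX : x ^+ m <= expR (t%:R * ((x ^+ 2 - 1) / 6)).
  have x0 : 0 < x by lra.
  rewrite -[x in x ^+ m]lnK ?posrE // -expRM_natl ler_expR.
  have -> : m%:R = t%:R * x / 3 :> R by rewrite /x; field; rewrite gt_eqF.
  have := ler_wpM2l (ltW t0R) (ln_le_subV x1); lra.
have y01 : 0 <= y <= 1.
  rewrite /y natrB //; apply/andP; split.
    by rewrite divr_ge0 ?mulr_ge0 ?subr_ge0 // ltW.
  by rewrite ler_pdivrMr; lra.
have yX : y ^+ (t - m) <= expR (t%:R * (2 / 3 *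
    (- (1 - y) + (1 - y) ^+ 2 / 2 + (1 - y) ^+ 3 / 2))).
  (* If [m = t], then [y = 0]: the left side is [0 ^+ 0 = 1] and the exponent on the right is 0. *)
  have [tm|tm] := leqP t m.
    have tmE : (t - m = 0)%N by lia.
    rewrite /y tmE expr0 mulr0 mul0r subr0 !expr1n.
    by rewrite (_ : t%:R * _ = 0) ?expR0 //; field.
  have y0 : 0 < y by rewrite /y divr_gt0 ?mulr_gt0 ?ltr0n ?subn_gt0.
  rewrite -[y in y ^+ (t - m)]lnK ?posrE // -expRM_natl ler_expR.
  have -> : (t - m)%:R = t%:R * (2 / 3 * y) :> R by rewrite /y; field; rewrite gt_eqF.
  have := ler_wpM2l (ltW t0R) (xlnx_le y01); lra.
have yE : 1 - y = 3 / 2 * delta.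
  by rewrite /y deltaE natrB //; field; rewrite gt_eqF.
have xE : x = 3 * delta + 1 by rewrite /x deltaE; field; rewrite gt_eqF.
have y0 : 0 <= y by case/andP: y01.
have x0 : 0 <= x by lra.
have := ler_pM (exprn_ge0 m x0) (exprn_ge0 (t - m) y0) xX yX.
rewrite -expRD -mulrDr yE {2}xE.
(* The terms linear in [delta] cancel, as they must for a relative entropy. *)
have -> : ((3 * delta + 1) ^+ 2 - 1) / 6 + 2 / 3 * (- (3 / 2 * delta) +
  (3 / 2 * delta) ^+ 2 / 2 + (3 / 2 * delta) ^+ 3 / 2) =
  9 / 4 * delta ^+ 2 + 9 / 8 * delta ^+ 3 by field.
move=> XY.
apply: le_trans (ler_wpM2l _ XY); last first.
  by rewrite !mulr_ge0 ?exprn_ge0.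
have tX : 0 < t%:R ^+ t :> R by rewrite exprn_gt0.
rewrite -(ler_pM2l tX).
have -> : t%:R ^+ t * (t.+1%:R * ('C(t, m)%:R * 2 ^+ (t - m)) * (x ^+ m * y ^+ (t - m))) =
  (t.+1%:R * ('C(t, m)%:R * m%:R ^+ m * (t - m)%:R ^+ (t - m))) * 3 ^+ t.
  rewrite /x /y !expr_div_n !exprMn.
  have splitX (a : R) : a ^+ t = a ^+ m * a ^+ (t - m) by rewrite -exprD subnKC.
  rewrite (splitX t%:R) (splitX 3); field.
  by rewrite !expf_neq0 ?gt_eqF.
rewrite ler_wpM2r ?exprn_ge0 //.
by rewrite -!natrX -!natrM ler_nat binomial_type_bound.
Qed.

(** Here [N] is ln n and [L] is log n in base 2. The factor [t + 1] and the entropy term share a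
    budget of 0.59 [N]; the extra [t^-1] in the bound on [delta] pays for rounding [m] up. *)
Lemma exponent_le (R : realType) (N L eps t delta : R) :
  N = L * ln 2 -> 137 / 2 <= N -> 5 * expR (- (1 / 10 * N)) < eps -> eps < 1 / 2 ->
  t <= 5 / 100 * eps ^- 2 * L -> 19 <= t ->
  4 / 3 * eps <= delta -> delta <= 4 / 3 * eps + t^-1 -> delta <= 2 / 3 ->
  (t + 1) * expR (t * (9 / 4 * delta ^+ 2 + 9 / 8 * delta ^+ 3)) <=
  expR (59 / 100 * N).
Proof.
move=> NE N0 eps_gt eps_lt t_le t19 delta_ge delta_le delta23.
have L_le : L <= 200 / 137 * N by have := @ln2_ge R; nra.
have eps0 : 0 < eps by have := @expR_gt0 R (- (1 / 10 * N)); lra.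
have eps20 : 0 < eps ^+ 2 by rewrite exprn_gt0.
have teps : t * eps ^+ 2 <= 73 / 1000 * N.
  have : t * eps ^+ 2 <= 5 / 100 * eps ^- 2 * L * eps ^+ 2 by rewrite ler_pM2r.
  have -> : 5 / 100 * eps ^- 2 * L * eps ^+ 2 = 5 / 100 * L by field; rewrite gt_eqF.
  lra.
have tV0 : 0 < t^-1 by rewrite invr_gt0; lra.
have tV : t^-1 <= 1 / 19 by rewrite -[1/19]invrK lef_pV2 ?posrE; lra.
have tdelta2 : t * delta ^+ 2 <= 16 / 9 * (73 / 1000 * N) + 8 / 3 * eps + 1 / 19.
  apply: le_trans (_ : t * (4 / 3 * eps + t^-1) ^+ 2 <= _).
    by rewrite ler_pM2l ?lerXn2r ?nnegrE; lra.
  have -> : t * (4 / 3 * eps + t^-1) ^+ 2 = 16 / 9 * (t * eps ^+ 2) + 8 / 3 * eps + t^-1.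
    by field; lra.
  lra.
have tdelta0 : 0 <= t * delta ^+ 2 by rewrite mulr_ge0 ?exprn_ge0; lra.
have expoE : t * (9 / 4 * delta ^+ 2 + 9 / 8 * delta ^+ 3) =
  (9 / 4 + 9 / 8 * delta) * (t * delta ^+ 2) by ring.
(* For eps <= 1 / 4 the factor t + 1 costs about n^(1/5), by the lower bound on
   eps; for larger eps, t is only O(log n). *)
have [eps4|eps4] := leP eps (1 / 4).
  (* The lower bound on [eps] gives [25 * t <= 0.073 * N * expR (N / 5)], hence the share 0.203. As
     [delta <= 1/3 + 1/19], the entropy factor [9/4 + 9/8 * delta] is at most 27/10, hence the share
     0.387. *)
  have -> : 59 / 100 * N = 203 / 1000 * N + 387 / 1000 * N by field.
  rewrite expRD ler_pM ?expR_ge0 //; first by lra.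
    have -> : 203 / 1000 * N = 1 / 5 * N + 3 / 1000 * N by field.
    have E5 : 1 <= expR (1 / 5 * N) by rewrite -{1}expR0 ler_expR; lra.
    have := @expR_ge1Dx R (3 / 1000 * N); rewrite expRD => E3.
    have : t * 25 <= 73 / 1000 * N * expR (1 / 5 * N).
      rewrite -(@ler_pM2r _ (expR (- (1 / 5 * N)))) ?expR_gt0 //.
      rewrite -[leRHS]mulrA expRxMexpNx_1 mulr1.
      apply: le_trans teps; rewrite -[leLHS]mulrA ler_pM2l; last lra.
      have -> : - (1 / 5 * N) = - (1 / 10 * N) + - (1 / 10 * N) by field.
      rewrite expRD; have := @expR_gt0 R (- (1 / 10 * N)); nra.
    nra.
  rewrite ler_expR expoE.
  apply: le_trans (_ : 27 / 10 * (t * delta ^+ 2) <= _); last lra.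
  by rewrite ler_wpM2r //; lra.
(* Now [1/16 <= eps ^+ 2] makes [t] linear in [N], so a fourth power dominates [t + 1];
   [delta <= 2/3] makes the entropy factor at most 3. *)
have -> : 59 / 100 * N = 130 / 1000 * N + 460 / 1000 * N by field.
rewrite expRD ler_pM ?expR_ge0 //; first by lra.
  have t_lin : t <= 16 * (73 / 1000 * N).
    have eps16 : 1 / 16 <= eps ^+ 2 by nra.
    have : t * (1 / 16) <= t * eps ^+ 2 by rewrite ler_wpM2l //; lra.
    lra.
  have -> : 130 / 1000 * N = 4%:R * (13 / 400 * N) by field.
  rewrite expRM_natl.
  apply: le_trans (_ : (1 + 13 / 400 * N) ^+ 4 <= _); last first.
    have N1 : 0 <= 1 + 13 / 400 * N by lra.
    by apply: lerXn2r (expR_ge1Dx _); rewrite nnegrE ?expR_ge0.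
  have -> : (1 + 13 / 400 * N) ^+ 4 = ((1 + 13 / 400 * N) ^+ 2) ^+ 2 by rewrite -exprM.
  have : 10 <= (1 + 13 / 400 * N) ^+ 2 by nra.
  nra.
rewrite ler_expR expoE.
apply: le_trans (_ : 3 * (t * delta ^+ 2) <= _); last lra.
by rewrite ler_wpM2r //; lra.
Qed.

(** Divided by [3 ^+ t], the last right-hand side is the probability that exactly [m] of [t] uniform
    draws from three values hit a given one: a single term of the tail suffices. *)
Lemma binomial_tail_ge (R : realType) (n t : nat) (eps : R) :
  2 ^+ 100 <= n%:R :> R -> 5 * n%:R `^ (- (1 / 10)) < eps -> eps < 1 / 2 ->
  t%:Z = Num.floor (5 / 100 * eps ^- 2 * log2 n%:R) ->
  (0 < t)%N /\ exists m, [/\ (m <= t)%N, t%:R * (1 / 3 + 4 / 3 * eps) <= m%:R &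
    n%:R `^ (- (59 / 100)) * 3 ^+ t <= ('C(t, m) * 2 ^ (t - m))%:R :> R].
Proof.
move=> n_ge eps_gt eps_lt tE.
have n0 : 0 < n%:R :> R by apply: lt_le_trans n_ge; rewrite exprn_gt0.
have ln20 : 0 < ln 2 :> R by have := @ln2_ge R; lra.
set N := ln n%:R : R; set L := log2 n%:R : R in tE.
have NE : N = L * ln 2 by rewrite /L /log2 divfK ?gt_eqF.
have N100 : 100 * ln 2 <= N.
  by rewrite mulrC mulr_natr -lnXn // ler_ln ?posrE ?exprn_gt0.
have L100 : 100 <= L by move: N100; rewrite NE ler_pM2r.
have N_ge : 137 / 2 <= N by have := @ln2_ge R; lra.
have powE a : n%:R `^ a = expR (a * N) by rewrite /powR gt_eqF.
rewrite powE mulNr in eps_gt.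
have eps0 : 0 < eps by have := @expR_gt0 R (- (1 / 10 * N)); lra.
have epsV : 4 <= eps ^- 2.
  by rewrite -[4]invrK lef_pV2 ?posrE ?exprn_gt0 // ; nra.
(* From [4 <= eps ^- 2] and [100 <= L]; the floor then leaves [t] at least 19. *)
have x20 : 20 <= 5 / 100 * eps ^- 2 * L by nra.
have x0 : 0 <= 5 / 100 * eps ^- 2 * L by lra.
have := floor_itv (5 / 100 * eps ^- 2 * L); rewrite -tE => /andP[t_le t_gt].
rewrite -pmulrn in t_le; rewrite intrD -pmulrn in t_gt.
have t19 : 19 <= t%:R :> R by lra.
set x := t%:R * (1 / 3 + 4 / 3 * eps).
have x_ge0 : 0 <= x by rewrite mulr_ge0 //; lra.
have /andP[x_ge x_lt] := truncn_itv x_ge0.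
have xt : x < t%:R by rewrite /x -[ltRHS]mulr1 ltr_pM2l; lra.
(* The least integer strictly above [x]; it stays at most [t] because [eps < 1 / 2] forces
   [x < t]. *)
set m := (Num.truncn x).+1 in x_lt.
have mt : (m <= t)%N by rewrite -(ltr_nat R); exact: le_lt_trans xt.
have mx : m%:R <= x + 1 by rewrite /m -addn1 natrD lerD2r.
have t0 : (0 < t)%N by rewrite -(ltr_nat R); lra.
split=> //; exists m; split=> //; first exact: ltW.
have tV : t%:R^-1 * t%:R = 1 :> R by rewrite mulVf // gt_eqF //; lra.
have tV0 : 0 < t%:R^-1 :> R by rewrite invr_gt0; lra.
pose delta : R := m%:R / t%:R - 1 / 3.
have delta_ge : 4 / 3 * eps <= delta.
  rewrite lerBrDr ler_pdivlMr; last lra.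
  by move: x_lt; rewrite /x; lra.
have delta_le : delta <= 4 / 3 * eps + t%:R^-1.
  rewrite lerBlDr ler_pdivrMr; last lra.
  by rewrite !mulrDl tV; move: mx; rewrite /x; lra.
have delta23 : delta <= 2 / 3.
  rewrite lerBlDr ler_pdivrMr; last lra.
  by move: mt; rewrite -(ler_nat R); lra.
have t3m : (t <= 3 * m)%N by rewrite -(ler_nat R) natrM; move: x_lt; rewrite /x; nra.
have := binomial_term_ge t0 mt t3m (erefl delta).
have := exponent_le NE N_ge eps_gt eps_lt t_le t19 delta_ge delta_le delta23.
set E := expR (t%:R * _) => E1 E2.
rewrite powE mulNr mulrC expRN ler_pdivrMr ?expR_gt0 //.
apply: le_trans E2 _; rewrite natrM natrX.
set B := 'C(t, m)%:R * _; rewrite -addn1 natrD.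
rewrite [leLHS](_ : _ = B * ((t%:R + 1) * E)); last ring.
by rewrite ler_wpM2l // mulr_ge0 ?exprn_ge0.
Qed.

(** Since [1 - p <= expR (- p)], it suffices to bound [k * p] below. The hypothesis on [k] yields k
    >= n/4, and n/4 times n^(-0.59) is n^0.39 times n^0.02 / 4. *)
Lemma onem_expn_le (R : realType) (n k : nat) :
  2 ^+ 100 <= n%:R :> R -> (n <= k.+1.*2)%N ->
  (1 - n%:R `^ (- (59 / 100))) ^+ k <= expR (- n%:R `^ (39 / 100)) :> R.
Proof.
move=> n_ge nk.
have n0 : 0 < n%:R :> R by apply: lt_le_trans n_ge; rewrite exprn_gt0.
have n1 : 1 <= n%:R :> R by apply: le_trans n_ge; rewrite exprn_ege1 // ler1n.
have n4 : 4 <= n%:R :> R.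
  apply: le_trans n_ge; rewrite (_ : 4 = 2 ^+ 2); last by ring.
  by rewrite ler_weXn2l // ler1n.
(* The 50th root of [2 ^+ 100] is 4, exactly the denominator of n/4. *)
have n02 : 4 <= n%:R `^ (1 / 50) :> R.
  have -> : 4 = (2 ^+ 100) `^ (1 / 50) :> R.
    rewrite -powR_mulrn // -powRrM.
    by rewrite (_ : 100%:R * (1 / 50) = 2%:R) ?powR_mulrn //; [ring | field].
  by rewrite ge0_ler_powR ?nnegrE ?exprn_ge0 //; lra.
set p := n%:R `^ (- (59 / 100)).
have p0 : 0 <= p by exact: powR_ge0.
have p1 : p <= 1.
  by rewrite -(powRr0 n%:R) /p ler_powR //; lra.
apply: le_trans (_ : expR (- p) ^+ k <= _).
  by rewrite lerXn2r ?nnegrE ?expR_ge0 //; [lra | exact: expR_ge1Dx].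
rewrite -expRM_natl ler_expR mulrN lerN2.
have k4 : n%:R / 4 <= k%:R :> R.
  move: nk; rewrite -(ler_nat R) -muln2 natrM -addn1 natrD; lra.
apply: le_trans (_ : n%:R / 4 * p <= _); last by rewrite ler_wpM2r.
have -> : n%:R / 4 * p = n%:R `^ (39 / 100) * n%:R `^ (1 / 50) / 4.
  rewrite -powRD; last by rewrite (gt_eqF n0) implybT.
  rewrite mulrAC /p -{1}(powRr1 (ltW n0)) -powRD; last by rewrite (gt_eqF n0) implybT.
  by congr (_ `^ _ / _); field.
have := powR_ge0 (n%:R : R) (39 / 100); nra.
Qed.

(** * Spanning trees of the windmill graph *)

(** At a deepest vertex of a cycle both cycle neighbours are no deeper, hence equal, but a cycle of
    length at least three has them distinct. *)
Lemma acyclic_of_depth (n : nat) (r : rel 'I_n) (d : 'I_n -> nat) :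
  symmetric r ->
  (forall x y z, r x y -> r x z -> (d y <= d x)%N -> (d z <= d x)%N -> y = z) ->
  rel_acyclic r.
Proof.
move=> rsym rd c /andP[cyc_c uniq_c]; rewrite ltnNge; apply/negP => c3.
have [x0 x0c] : exists x0, x0 \in c.
  by case: c c3 {cyc_c uniq_c} => // x0 c _; exists x0; rewrite mem_head.
have [x xc xmax] := arg_maxnP d x0c.
have [i c' rotE] := rot_to xc.
have xmax' y : y \in x :: c' -> (d y <= d x)%N by rewrite -rotE mem_rot => /xmax.
move: c3 cyc_c uniq_c; rewrite -(rot_cycle i) -(rot_uniq i) -(size_rot i) rotE.
case: c' {rotE} xmax' => [//|y p] xmax'; case/lastP: p xmax' => [//|p z] xmax' _.
rewrite /= rcons_path last_rcons => /andP[rxy /andP[_ rzx]].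
have -> : y = z.
  apply: (rd x); rewrite // 1?rsym //; apply: xmax'.
  - by rewrite !inE eqxx orbT.
  - by rewrite !inE mem_rcons mem_head !orbT.
by rewrite mem_rcons mem_head andbF.
Qed.

Section Windmill.
Variable n : nat.

(* Blades are the triangles {0, 2 i + 1, 2 i + 2}; when n is odd, the vertex n
   is a leaf attached to the hub 0. *)
Definition windmill_adj : rel 'I_n.+1 := fun u v =>
  (u != v) && [|| u == ord0, v == ord0 | (u.-1)./2 == (v.-1)./2].

Lemma windmill_adj_sym : symmetric windmill_adj.
Proof. by move=> u v; rewrite /windmill_adj eq_sym (eq_sym u.-1./2) orbCA. Qed.

Lemma windmill_adj_irr : irreflexive windmill_adj.
Proof. by move=> u; rewrite /windmill_adj eqxx. Qed.

Definition windmill : sgraph n.+1 := SGraph windmill_adj_sym windmill_adj_irr.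

Lemma windmill_connected : rel_connected (adj windmill).
Proof.
have hub v : connect (adj windmill) ord0 v.
  have [->|v0] := eqVneq v ord0; first exact: connect0.
  by apply: connect1; rewrite /= /windmill_adj eq_sym v0.
move=> u v; apply: connect_trans (hub v).
by rewrite sym_connect_sym //; exact: windmill_adj_sym.
Qed.

Lemma edgeE (e : 'I_n.+1 * 'I_n.+1) : (e \in edges windmill) =
  (e.1 < e.2)%N && ((e.1 == 0 :> nat) || (e.1.-1./2 == e.2.-1./2)).
Proof.
rewrite inE /= /windmill_adj -!val_eqE /=; have [e12|//] := ltnP e.1 e.2.
by rewrite (ltn_eqF e12) /=; case: eqP => //= _; rewrite gtn_eqF //; lia.
Qed.

Lemma odd_rim_lt (i : 'I_n./2) : (i.*2.+1 < n.+1)%N.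
Proof. by have := ltn_ord i; lia. Qed.

Lemma even_rim_lt (i : 'I_n./2) : (i.*2.+2 < n.+1)%N.
Proof. by have := ltn_ord i; lia. Qed.

Definition odd_rim (i : 'I_n./2) : 'I_n.+1 := Ordinal (odd_rim_lt i).
Definition even_rim (i : 'I_n./2) : 'I_n.+1 := Ordinal (even_rim_lt i).

(** The rim edge gets index [ord0], the value that the counting lemmas on functions into ['I_3]
    single out. *)
Definition rim_edge : 'I_3 := ord0.
Definition odd_spoke : 'I_3 := @Ordinal 3 1 isT.
Definition even_spoke : 'I_3 := @Ordinal 3 2 isT.

Lemma blade_indexP (j : 'I_3) :
  [\/ j = rim_edge, j = odd_spoke | j = even_spoke].
Proof.
case: j => [[|[|[|//]]] ?];
  [apply: Or31 | apply: Or32 | apply: Or33]; exact: val_inj.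
Qed.

Definition blade (i : 'I_n./2) (j : 'I_3) : 'I_n.+1 * 'I_n.+1 :=
  if j == rim_edge then (odd_rim i, even_rim i)
  else if j == odd_spoke then (ord0, odd_rim i) else (ord0, even_rim i).

Lemma blade_inj i j i' j' : blade i j = blade i' j' -> i = i' /\ j = j'.
Proof.
rewrite /blade => E; split; apply: val_inj; move: E;
  case: j j' => [[|[|[|//]]] ?] [[|[|[|//]]] ?] //= [] ; lia.
Qed.

Lemma blade_edge i j : blade i j \in edges windmill.
Proof.
by rewrite edgeE /blade; case: j => [[|[|[|//]]] ?] //=; lia.
Qed.

Lemma rimP (v : 'I_n.+1) : [\/ v = ord0, exists i, v = odd_rim i,
  exists i, v = even_rim i | odd n /\ v = ord_max].
Proof.
have vn := ltn_ord v.
have [v0|v0] := posnP v; first by apply: Or41; apply: val_inj.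
have [nv|vn'] := leqP n./2 v.-1./2.
  by apply: Or44; split; [lia | apply: val_inj => /=; lia].
have [v_odd|v_even] := boolP (odd v).
  by apply: Or42; exists (Ordinal vn'); apply: val_inj => /=; lia.
by apply: Or43; exists (Ordinal vn'); apply: val_inj => /=; lia.
Qed.

Variant edge_spec (e : 'I_n.+1 * 'I_n.+1) : Prop :=
  | EdgeBlade i j of e = blade i j
  | EdgeLeaf of odd n & e = (ord0, ord_max).

Lemma edgeP e : e \in edges windmill -> edge_spec e.
Proof.
case: e => u v; rewrite edgeE /= => /andP[uv uvE].
have [u0|u0] := posnP u.
  have {u0} uE : u = ord0 by apply: val_inj.
  subst u; have [vE|[i ->]|[i ->]|[n_odd ->]] := rimP v.
  - by move: uv; rewrite vE.
  - exact: (@EdgeBlade _ i odd_spoke).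
  - exact: (@EdgeBlade _ i even_spoke).
  - exact: EdgeLeaf.
move: uvE; rewrite gtn_eqF //= => /eqP uvE.
have vn := ltn_ord v.
have ltu : (u.-1./2 < n./2)%N by lia.
apply: (@EdgeBlade _ (Ordinal ltu) rim_edge).
by congr pair; apply: val_inj => /=; lia.
Qed.

Lemma blade_disjoint i e : e \in edges windmill -> (forall j, e <> blade i j) ->
  [/\ e.1 <> odd_rim i, e.1 <> even_rim i, e.2 <> odd_rim i & e.2 <> even_rim i].
Proof.
move=> /edgeP[i' j' ->|n_odd ->] neq; last first.
  by have := ltn_ord i; split=> /(congr1 val) /=; lia.
have ii' : i' <> i :> nat.
  by move=> /val_inj ii'; apply: (neq j'); rewrite ii'.
by rewrite /blade; case: j' {neq} => [[|[|[|//]]] ?]; split=> /(congr1 val) /=; lia.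
Qed.

(* In each blade i the edge of index f i is missing. *)
Definition blade_tree (f : {ffun 'I_n./2 -> 'I_3}) : {set 'I_n.+1 * 'I_n.+1} :=
  (edges windmill :\: [set blade i (f i) | i : 'I_n./2])%SET.

Lemma blade_in_tree f i j : (blade i j \in blade_tree f) = (j != f i).
Proof.
rewrite inE blade_edge andbT; congr (~~ _).
apply/imsetP/eqP => [[i' _ /blade_inj[<- //]]|->].
by exists i.
Qed.

Lemma leaf_in_tree f : odd n -> (ord0, ord_max) \in blade_tree f.
Proof.
move=> n_odd; rewrite finset.in_setD edgeE /= odd_gt0 //= andbT; apply/imsetP => -[i _].
have := ltn_ord i; rewrite /blade; case: (f i) => [[|[|[|//]]] ?] ? [] //=; lia.
Qed.

Lemma blade_tree_inj : injective blade_tree.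
Proof.
move=> f g fg; apply/ffunP => i; apply/eqP; rewrite -[_ == _]negbK.
by rewrite -blade_in_tree -fg blade_in_tree eqxx.
Qed.

Lemma blade_vertex i i' j' :
  (blade i' j').1 = odd_rim i \/ (blade i' j').2 = odd_rim i \/
  (blade i' j').1 = even_rim i \/ (blade i' j').2 = even_rim i -> i' = i.
Proof.
move=> H; apply: val_inj; move: H; rewrite /blade.
by have [->|->|->] := blade_indexP j'; case=> [|[|[|]]] /(congr1 val) /=; lia.
Qed.

(** * The shape of an arbitrary spanning tree *)

Section SpanningTree.
Variable T : {set 'I_n.+1 * 'I_n.+1}.
Hypothesis TG : T \subset edges windmill.

Lemma odd_rim_nbr i y : edge_rel T (odd_rim i) y ->
  (y = ord0 /\ blade i odd_spoke \in T) \/ (y = even_rim i /\ blade i rim_edge \in T).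
Proof.
have in_ := ltn_ord i.
move=> /orP[] yT; have /edgeP[i' j' E|_ E] := fintype.subsetP TG _ yT.
- have ii' : i' = i by apply: (@blade_vertex _ _ j'); rewrite -E; left.
  move: E yT; rewrite ii'; have [->|->|->] := blade_indexP j' => E yT;
    have /(congr1 val) /= E1 := congr1 fst E; have E2 := congr1 snd E; try lia.
  by right; split; [exact: E2 | rewrite -E].
- by have /(congr1 val) /= E1 := congr1 fst E.
- have ii' : i' = i by apply: (@blade_vertex _ _ j'); rewrite -E; right; left.
  move: E yT; rewrite ii'; have [->|->|->] := blade_indexP j' => E yT;
    have E1 := congr1 fst E; have /(congr1 val) /= E2 := congr1 snd E; try lia.
  by left; split; [exact: E1 | rewrite -E].
- by have /(congr1 val) /= E1 := congr1 snd E; lia.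
Qed.

Lemma even_rim_nbr i y : edge_rel T (even_rim i) y ->
  (y = ord0 /\ blade i even_spoke \in T) \/ (y = odd_rim i /\ blade i rim_edge \in T).
Proof.
have in_ := ltn_ord i.
move=> /orP[] yT; have /edgeP[i' j' E|n_odd E] := fintype.subsetP TG _ yT.
- have ii' : i' = i by apply: (@blade_vertex _ _ j'); rewrite -E; right; right; left.
  move: E yT; rewrite ii'; have [->|->|->] := blade_indexP j' => E yT;
    have /(congr1 val) /= E1 := congr1 fst E; lia.
- by have /(congr1 val) /= E1 := congr1 fst E.
- have ii' : i' = i by apply: (@blade_vertex _ _ j'); rewrite -E; right; right; right.
  move: E yT; rewrite ii'; have [->|->|->] := blade_indexP j' => E yT;
    have E1 := congr1 fst E; have /(congr1 val) /= E2 := congr1 snd E; try lia.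
  + by right; split; [exact: E1 | rewrite -E].
  + by left; split; [exact: E1 | rewrite -E].
- by have /(congr1 val) /= E1 := congr1 snd E; lia.
Qed.

Lemma leaf_nbr y : odd n -> edge_rel T ord_max y ->
  y = ord0 /\ (ord0, ord_max) \in T.
Proof.
move=> n_odd /orP[] yT; have /edgeP[i j E|_ E] := fintype.subsetP TG _ yT.
- have /(congr1 val) /= := congr1 fst E; have := ltn_ord i.
  by have [->|->|->] := blade_indexP j => /=; lia.
- by have /(congr1 val) /= E1 := congr1 fst E; lia.
- have /(congr1 val) /= := congr1 snd E; have := ltn_ord i.
  by have [->|->|->] := blade_indexP j => /=; lia.
- by have E1 := congr1 fst E; split; [exact: E1 | rewrite -E].
Qed.

Lemma edge_rel_sym : symmetric (edge_rel T).
Proof. by move=> u v; rewrite /edge_rel /= orbC. Qed.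

(** A set closed under adjacency is a union of components, so here it separates [v] from the hub. *)
Lemma not_connected_hub (A : {pred 'I_n.+1}) (v : 'I_n.+1) :
  (forall u w, edge_rel T u w -> u \in A -> w \in A) -> v \in A -> ord0 \notin A ->
  ~ rel_connected (edge_rel T).
Proof.
move=> clA vA hubA conn; have symT := sym_connect_sym edge_rel_sym.
have := closed_connect (intro_closed symT clA) (conn v ord0).
by rewrite vA (negPf hubA).
Qed.

Hypothesis Tconn : rel_connected (edge_rel T).

(** Two missing edges cut vertices off from the hub: one rim vertex if the rim edge is among them,
    the pair of rim vertices if both spokes are missing. *)
Lemma blade_missing_le1 i j j' : blade i j \notin T -> blade i j' \notin T -> j = j'.
Proof.
wlog jj' : j j' / (j < j')%N.
  move=> W jT j'T; have [jj'|j'j|/val_inj //] := ltngtP j j'; first exact: W.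
  by rewrite (W j' j).
move=> jT j'T; exfalso; move: jj' jT j'T.
have [->|->|->] := blade_indexP j; have [->|->|->] := blade_indexP j' => //= _ jT j'T.
- apply: (@not_connected_hub (pred1 (odd_rim i)) (odd_rim i)) Tconn;
    rewrite ?inE ?eqxx //.
  move=> u w uw; rewrite !inE => /eqP uE; move: uw.
  by rewrite uE => /odd_rim_nbr[[_]|[_]]; rewrite ?(negPf jT) ?(negPf j'T).
- apply: (@not_connected_hub (pred1 (even_rim i)) (even_rim i)) Tconn;
    rewrite ?inE ?eqxx //.
  move=> u w uw; rewrite !inE => /eqP uE; move: uw.
  by rewrite uE => /even_rim_nbr[[_]|[_]]; rewrite ?(negPf jT) ?(negPf j'T).
- apply: (@not_connected_hub (pred2 (odd_rim i) (even_rim i)) (odd_rim i)) Tconn;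
    rewrite ?inE ?eqxx //.
  move=> u w uw; rewrite !inE => /orP[]/eqP uE; move: uw; rewrite uE.
  + move=> /odd_rim_nbr[[_]|[-> _]]; first by rewrite (negPf jT).
    by rewrite eqxx orbT.
  + move=> /even_rim_nbr[[_]|[-> _]]; first by rewrite (negPf j'T).
    by rewrite eqxx.
Qed.

Lemma leaf_edge_in : odd n -> (ord0, ord_max) \in T.
Proof.
move=> n_odd; apply/negPn/negP => leafT.
apply: (@not_connected_hub (pred1 ord_max) ord_max) Tconn.
- move=> u w uw; rewrite !inE => /eqP uE; move: uw.
  by rewrite uE => /(leaf_nbr n_odd)[_]; rewrite (negPf leafT).
- by rewrite inE.
- by rewrite inE; apply/eqP => /(congr1 val) /=; lia.
Qed.

Hypothesis Tacyc : rel_acyclic (edge_rel T).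

Lemma blade_missing i : exists j, blade i j \notin T.
Proof.
apply/existsP; rewrite -[[exists _, _]]negbK negb_exists; apply/negP => /forallP allT.
have inT j : blade i j \in T by rewrite -[_ \in _]negbK.
(* With all its edges present, the blade would be a cycle of length three. *)
have := Tacyc (c := [:: ord0; odd_rim i; even_rim i]).
rewrite /ucycle /edge_rel /= (inT odd_spoke) (inT rim_edge) (inT even_spoke).
rewrite !orbT /= !inE.
by rewrite -val_eqE /= ltn_eqF // => /(_ isT).
Qed.

Lemma spanning_tree_blade_tree : exists f, T = blade_tree f.
Proof.
pose f := [ffun i => xchoose (blade_missing i)].
have fT i : blade i (f i) \notin T by rewrite ffunE; exact: (xchooseP (blade_missing i)).
exists f; apply/setP => e.
have [eG|eG] := boolP (e \in edges windmill); last first.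
  rewrite finset.in_setD (negPf eG) andbF.
  by apply/negP => /(fintype.subsetP TG); apply/negP.
have [i j ->|n_odd ->] := edgeP eG; last by rewrite leaf_edge_in ?leaf_in_tree.
rewrite blade_in_tree; apply/idP/idP => [jT|].
  by apply: contraNneq (fT i) => <-.
by apply: contraNT => jT; apply/eqP; exact: blade_missing_le1 jT (fT i).
Qed.

End SpanningTree.

(** * Each choice of one missing edge per blade gives a spanning tree *)

Lemma blade_tree_sub f : blade_tree f \subset edges windmill.
Proof. exact: subsetDl. Qed.

(** A rim vertex whose spoke is missing is reached through the other rim vertex, the other two edges
    of the blade being present. *)
Lemma blade_tree_connected f : rel_connected (edge_rel (blade_tree f)).
Proof.
have csym := sym_connect_sym (edge_rel_sym (blade_tree f)).
have hub v : connect (edge_rel (blade_tree f)) ord0 v.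
  have spoke w : (ord0, w) \in blade_tree f -> connect (edge_rel (blade_tree f)) ord0 w.
    by move=> wT; apply: connect1; rewrite /edge_rel /= wT.
  have [->|[i ->]|[i ->]|[n_odd ->]] := rimP v.
  - exact: connect0.
  - have [fi|fi] := eqVneq (f i) odd_spoke; last first.
      by apply: spoke; rewrite (blade_in_tree f i odd_spoke) eq_sym.
    apply: connect_trans (_ : connect _ (even_rim i) _).
      by apply: spoke; rewrite (blade_in_tree f i even_spoke) fi.
    by apply: connect1; rewrite /edge_rel /= (blade_in_tree f i rim_edge) fi orbT.
  - have [fi|fi] := eqVneq (f i) even_spoke; last first.
      by apply: spoke; rewrite (blade_in_tree f i even_spoke) eq_sym.
    apply: connect_trans (_ : connect _ (odd_rim i) _).
      by apply: spoke; rewrite (blade_in_tree f i odd_spoke) fi.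
    by apply: connect1; rewrite /edge_rel /= (blade_in_tree f i rim_edge) fi.
  - by apply: spoke; exact: leaf_in_tree.
by move=> u v; apply: connect_trans (hub v); rewrite csym.
Qed.

Lemma blade_tree_acyclic f : rel_acyclic (edge_rel (blade_tree f)).
Proof.
set T := blade_tree f; have TG := blade_tree_sub f.
(* The distance to the hub in the tree; no vertex has two distinct neighbours that are no deeper
   than itself. *)
pose d (v : 'I_n.+1) := if v == ord0 then 0%N else if (ord0, v) \in T then 1%N else 2%N.
apply: (@acyclic_of_depth _ _ d) => [|x y z]; first exact: edge_rel_sym.
have not_all i : blade i rim_edge \in T -> blade i odd_spoke \in T ->
    blade i even_spoke \in T -> False.
  rewrite !blade_in_tree; have [->|->|->] := blade_indexP (f i) => //.
have dodd i : blade i odd_spoke \in T -> d (odd_rim i) = 1%N by rewrite /d /= => ->.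
have deven i : blade i even_spoke \in T -> d (even_rim i) = 1%N by rewrite /d /= => ->.
have [->|[i ->]|[i ->]|[n_odd ->]] := rimP x.
- by rewrite /d eqxx; case: eqP => [->|_]; case: eqP => [->|_] //; case: ifP.
- move=> /(odd_rim_nbr TG)[[-> y1]|[-> y0]] /(odd_rim_nbr TG)[[-> z1]|[-> z0]] //.
  + rewrite (dodd _ y1) => _; rewrite /d /=.
    by case: ifP => // y2; case: (not_all i).
  + rewrite (dodd _ z1); rewrite /d /=.
    by case: ifP => // y2; case: (not_all i).
- move=> /(even_rim_nbr TG)[[-> y1]|[-> y0]] /(even_rim_nbr TG)[[-> z1]|[-> z0]] //.
  + rewrite (deven _ y1) => _; rewrite /d /=.
    by case: ifP => // y2; case: (not_all i).
  + rewrite (deven _ z1); rewrite /d /=.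
    by case: ifP => // y2; case: (not_all i).
- by move=> /(leaf_nbr TG n_odd)[-> _] /(leaf_nbr TG n_odd)[-> _].
Qed.

Lemma spanning_trees_windmill : spanning_trees windmill = 
  [set blade_tree f | f : {ffun 'I_n./2 -> 'I_3}]%SET.
Proof.
apply/setP => T; rewrite inE; apply/asboolP/imsetP => [[TG Tconn Tacyc]|[f _ ->]].
  by have [f ->] := spanning_tree_blade_tree TG Tconn Tacyc; exists f; rewrite ?inE.
split; [exact: blade_tree_sub | exact: blade_tree_connected | exact: blade_tree_acyclic].
Qed.

Lemma card_spanning_trees_windmill :
  #|spanning_trees windmill| = (3 ^ n./2)%N.
Proof.
rewrite spanning_trees_windmill card_imset; last exact: blade_tree_inj.
by rewrite card_ffun !card_ord.
Qed.

(** Localizes an edge sum to one triangle; the membership indicators let the same formula serve the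
    whole graph and its trees. *)
Lemma sum_blade (V : nmodType) (S : {set 'I_n.+1 * 'I_n.+1}) i
    (F : 'I_n.+1 * 'I_n.+1 -> V) : S \subset edges windmill ->
  (forall e, e \in edges windmill -> (forall j, e <> blade i j) -> F e = 0) ->
  \sum_(e in S) F e = F (blade i rim_edge) *+ (blade i rim_edge \in S) +
    F (blade i odd_spoke) *+ (blade i odd_spoke \in S) +
    F (blade i even_spoke) *+ (blade i even_spoke \in S).
Proof.
move=> /fintype.subsetP SG F0.
transitivity (\sum_(j < 3) F (blade i j) *+ (blade i j \in S)); last first.
  by rewrite !big_ord_recl big_ord0 addr0 addrA; do 2?[congr (_ + _)];
    rewrite (_ : lift _ _ = _) //; apply: val_inj.
rewrite (bigID (mem [set blade i j | j : 'I_3]%SET)) /= addrC big1 ?add0r.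
  under eq_bigl do rewrite andbC.
  rewrite big_mkcondr big_imset /=; last by move=> j j' _ _ /blade_inj[].
  by apply: eq_big => [j|j _]; rewrite ?inE ?mulrb.
move=> e /andP[/SG eG /imsetP ne]; apply: F0 => // j ej.
by apply: ne; exists j.
Qed.

End Windmill.

(** * Laplacians *)

Section WeightedLaplacian.
Context {R : realType} {n : nat}.
Implicit Types (S : {set 'I_n * 'I_n}) (w : 'I_n * 'I_n -> R) (x : 'cV[R]_n).

Definition weighted_laplacian S w : 'M[R]_n :=
  \sum_(e in S) w e *: (edge_vec R e *m (edge_vec R e)^T).

Lemma laplacianE (G : sgraph n) :
  laplacian R G = weighted_laplacian (edges G) (fun=> 1).
Proof. by apply: eq_bigr => e _; rewrite scale1r. Qed.

Lemma edge_vec_mul (e : 'I_n * 'I_n) x :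
  (edge_vec R e)^T *m x = (x e.1 0 - x e.2 0)%:M.
Proof.
rewrite [LHS]mx11_scalar mxE; congr (_%:M).
under eq_bigr do rewrite !mxE mulrBl.
rewrite sumrB (bigD1 e.1) //= big1 => [|i /negPf ->]; last by rewrite mul0r.
rewrite (bigD1 e.2) //= big1 => [|i /negPf ->]; last by rewrite mul0r.
by rewrite !eqxx !mul1r !addr0.
Qed.

Lemma weighted_laplacian_mul S w x :
  weighted_laplacian S w *m x =
    \sum_(e in S) (w e * (x e.1 0 - x e.2 0)) *: edge_vec R e.
Proof.
rewrite mulmx_suml; apply: eq_bigr => e _.
by rewrite -scalemxAl -mulmxA edge_vec_mul mul_mx_scalar scalerA.
Qed.

Lemma weighted_laplacian_quad S w x :
  (x^T *m weighted_laplacian S w *m x) 0 0 =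
    \sum_(e in S) w e * (x e.1 0 - x e.2 0) ^+ 2.
Proof.
rewrite -mulmxA weighted_laplacian_mul mulmx_sumr summxE; apply: eq_bigr => e _.
rewrite -scalemxAr -[x^T *m _]trmxK trmx_mul trmxK edge_vec_mul !mxE eqxx.
by rewrite mulr1n expr2 mulrA.
Qed.

Lemma laplacian_sym (G : sgraph n) : (laplacian R G)^T = laplacian R G.
Proof.
by rewrite raddf_sum /=; apply: eq_bigr => e _; rewrite trmx_mul trmxK.
Qed.

(** Any potential [x] replaces the pseudoinverse: with b = L x and L symmetric, the Penrose identity
    turns the leverage score into x^T L x = b^T x, an effective resistance. *)
Lemma leverage_potential (G : sgraph n) (e : 'I_n * 'I_n) x :
  laplacian R G *m x = edge_vec R e -> leverage R G e = x e.1 0 - x e.2 0.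
Proof.
move=> Lx; have [LL _ _ _] := mp_inverseP (laplacian R G).
have levE : (edge_vec R e)^T *m mp_inverse (laplacian R G) *m edge_vec R e =
    (edge_vec R e)^T *m x.
  by rewrite -Lx trmx_mul laplacian_sym !mulmxA -(mulmxA x^T) -(mulmxA x^T) LL.
by rewrite /leverage levE edge_vec_mul mxE eqxx mulr1n.
Qed.
End WeightedLaplacian.

(** * Quadratic forms and leverage scores in a blade *)

Section WindmillLaplacian.
Context {R : realType} {n : nat}.
Implicit Types (i : 'I_n./2) (p q c : R) (f : {ffun 'I_n./2 -> 'I_3}).

(** The shift by [c] changes no difference along an edge; it serves to make the entries sum to
    zero. *)
Definition blade_vec i p q c : 'cV[R]_n.+1 :=
  \col_v (p * (v == odd_rim i)%:R + q * (v == even_rim i)%:R - c).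

Let even_odd i : (even_rim i == odd_rim i) = false.
Proof. by rewrite -val_eqE /= gtn_eqF. Qed.

Lemma blade_vec_hub i p q c : blade_vec i p q c ord0 0 = - c.
Proof. by rewrite mxE /= !mulr0 !add0r. Qed.

Lemma blade_vec_odd i p q c : blade_vec i p q c (odd_rim i) 0 = p - c.
Proof. by rewrite mxE eqxx eq_sym even_odd mulr1 mulr0 addr0. Qed.

Lemma blade_vec_even i p q c : blade_vec i p q c (even_rim i) 0 = q - c.
Proof. by rewrite mxE eqxx even_odd mulr1 mulr0 add0r. Qed.

Lemma blade_vec_off i p q c e : e \in edges (windmill n) ->
  (forall j, e <> blade i j) ->
  blade_vec i p q c e.1 0 - blade_vec i p q c e.2 0 = 0.
Proof.
move=> eG /(blade_disjoint eG)[/eqP/negPf e1 /eqP/negPf e2 /eqP/negPf e3 /eqP/negPf e4].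
by rewrite !mxE e1 e2 e3 e4 subrr.
Qed.

Lemma blade_vec_sum i p q c : \sum_v blade_vec i p q c v 0 = p + q - c *+ n.+1.
Proof.
under eq_bigr do rewrite mxE.
rewrite sumrB big_split /= sumr_const card_ord (bigD1 (odd_rim i)) //=.
rewrite big1 => [|v /negPf ->]; last by rewrite mulr0.
rewrite (bigD1 (even_rim i)) //= big1 => [|v /negPf ->]; last by rewrite mulr0.
by rewrite !eqxx !mulr1 !addr0.
Qed.

Lemma blade_vec_quad (S : {set 'I_n.+1 * 'I_n.+1}) w i p q c :
  S \subset edges (windmill n) ->
  ((blade_vec i p q c)^T *m weighted_laplacian S w *m blade_vec i p q c) 0 0 =
  w (blade i rim_edge) * (p - q) ^+ 2 *+ (blade i rim_edge \in S) +
  w (blade i odd_spoke) * p ^+ 2 *+ (blade i odd_spoke \in S) +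
  w (blade i even_spoke) * q ^+ 2 *+ (blade i even_spoke \in S).
Proof.
move=> SG; rewrite weighted_laplacian_quad (sum_blade (i := i) SG) => [|e eG ej]; last first.
  by rewrite blade_vec_off // expr0n mulr0.
rewrite /blade /= !blade_vec_hub !blade_vec_odd !blade_vec_even.
congr (_ * _ *+ _ + _ * _ *+ _ + _ * _ *+ _); ring.
Qed.

Lemma laplacian_blade_vec i p q c : laplacian R (windmill n) *m blade_vec i p q c =
  (p - q) *: edge_vec R (blade i rim_edge) -
  p *: edge_vec R (blade i odd_spoke) - q *: edge_vec R (blade i even_spoke).
Proof.
rewrite laplacianE weighted_laplacian_mul (sum_blade (i := i)) // => [|e eG ej]; last first.
  by rewrite blade_vec_off // mulr0 scale0r.
rewrite !blade_edge !mulr1n /blade /= !blade_vec_hub !blade_vec_odd !blade_vec_even.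
by rewrite -!scaleNr; congr (_ *: _ + _ *: _ + _ *: _); ring.
Qed.

(** One unit resistor in parallel with two in series has resistance 2/3. The witnesses are the
    potentials of a unit current between the endpoints, normalized to 0 at the hub. *)
Lemma leverage_blade i j : leverage R (windmill n) (blade i j) = 2 / 3.
Proof.
have [->|->|->] := blade_indexP j.
- rewrite (@leverage_potential _ _ _ _ (blade_vec i (1 / 3) (- (1 / 3)) 0)).
    by rewrite /blade /= blade_vec_odd blade_vec_even; field.
  by rewrite laplacian_blade_vec; apply/colP => v; rewrite !mxE /=; field.
- rewrite (@leverage_potential _ _ _ _ (blade_vec i (- (2 / 3)) (- (1 / 3)) 0)).
    by rewrite /blade /= blade_vec_odd blade_vec_hub; field.
  by rewrite laplacian_blade_vec; apply/colP => v; rewrite !mxE /=; field.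
- rewrite (@leverage_potential _ _ _ _ (blade_vec i (- (1 / 3)) (- (2 / 3)) 0)).
    by rewrite /blade /= blade_vec_even blade_vec_hub; field.
  by rewrite laplacian_blade_vec; apply/colP => v; rewrite !mxE /=; field.
Qed.

Lemma laplacian_blade_quad i p q c :
  ((blade_vec i p q c)^T *m laplacian R (windmill n) *m blade_vec i p q c) 0 0 =
  (p - q) ^+ 2 + p ^+ 2 + q ^+ 2.
Proof. by rewrite laplacianE blade_vec_quad // !blade_edge !mulr1n !mul1r. Qed.

Lemma tree_laplacian_blade_quad f i p q c :
  ((blade_vec i p q c)^T *m tree_laplacian R (windmill n) (blade_tree f) *m
    blade_vec i p q c) 0 0 =
  3 / 2 * ((p - q) ^+ 2 *+ (f i != rim_edge) + p ^+ 2 *+ (f i != odd_spoke) +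
    q ^+ 2 *+ (f i != even_spoke)).
Proof.
rewrite [tree_laplacian _ _ _]/(weighted_laplacian _ (fun e => (leverage R _ e)^-1)).
rewrite blade_vec_quad ?blade_tree_sub // !leverage_blade !blade_in_tree.
by rewrite !(eq_sym (f i)) invf_div !mulrDr !mulrnAr.
Qed.

Section Average.
Variables (t : nat) (F : 'I_t -> {ffun 'I_n./2 -> 'I_3}).

Let avg : 'M[R]_n.+1 :=
  t%:R^-1 *: \sum_(l < t) tree_laplacian R (windmill n) (blade_tree (F l)).

Lemma quad_avg (x : 'cV[R]_n.+1) : (x^T *m avg *m x) 0 0 =
  t%:R^-1 * \sum_(l < t)
    (x^T *m tree_laplacian R (windmill n) (blade_tree (F l)) *m x) 0 0.
Proof.
rewrite -scalemxAr -scalemxAl mxE mulmx_sumr mulmx_suml summxE //.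
Qed.

Lemma sum_if_card (A : pred 'I_t) (a b : R) :
  \sum_(l < t) (if A l then a else b) = b * t%:R + (a - b) * #|A|%:R.
Proof.
transitivity (\sum_(l < t) (b + (a - b) *+ A l)).
  by apply: eq_bigr => l _; case: (A l); rewrite ?mulr1n ?mulr0n; ring.
rewrite big_split /= sumr_const card_ord mulr_natr; congr (_ + _).
rewrite mulr_natr -sumr_const [RHS]big_mkcond.
by apply: eq_bigr => l _; rewrite mulrb.
Qed.

(* In a blade {0, a, b} the vector 1_a - 1_b witnesses the failure of the lower
   bound, and 1_a + 1_b, made orthogonal to the constants, that of the upper one. *)
Lemma avg_not_approx i (eps : R) : (0 < t)%N ->
  t%:R * (1 / 3 + 4 / 3 * eps) <= #|[pred l | F l i == rim_edge]|%:R ->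
  ~ lap_lt ((1 - eps) *: laplacian R (windmill n)) avg /\
  ~ lap_lt avg ((1 + eps) *: laplacian R (windmill n)).
Proof.
move=> t0 card_ge; have t0R : 0 < t%:R :> R by rewrite ltr0n.
split=> lt_avg.
- have := lt_avg (blade_vec i 1 (-1) 0); rewrite blade_vec_sum.
  rewrite quad_avg -scalemxAr -scalemxAl mxE laplacian_blade_quad.
  under eq_bigr do rewrite tree_laplacian_blade_quad.
  (* The form of the graph is 6 here, and the average is at most [15/2 - 9/2 * (1/3 + 4/3 * eps) = 6
     * (1 - eps)]. *)
  rewrite (eq_bigr (fun l => if F l i == rim_edge then 3 else 15 / 2)); last first.
    by move=> l _; have [->|->|->] := blade_indexP (F l i) => /=; field.
  rewrite sum_if_card => H.
  have /H : blade_vec i 1 (-1) 0 != 0.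
    apply/eqP => /colP/(_ (odd_rim i)); rewrite blade_vec_odd mxE => /eqP.
    by rewrite subr0 oner_eq0.
  rewrite mul0rn subr0 subrr => /(_ erefl).
  by rewrite -ltr_pdivrMl ?invr_gt0 // invrK; lra.
- have := lt_avg (blade_vec i 1 1 (2 / n.+1%:R)); rewrite blade_vec_sum.
  rewrite quad_avg -scalemxAr -scalemxAl mxE laplacian_blade_quad.
  under eq_bigr do rewrite tree_laplacian_blade_quad.
  (* The form of the graph is 2 here, and the average is at least [3/2 + 3/2 * (1/3 + 4/3 * eps) = 2
     * (1 + eps)]: the same threshold is sharp for both witnesses. *)
  rewrite (eq_bigr (fun l => if F l i == rim_edge then 3 else 3 / 2)); last first.
    by move=> l _; have [->|->|->] := blade_indexP (F l i) => /=; field.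
  rewrite sum_if_card => H.
  have /H : blade_vec i 1 1 (2 / n.+1%:R) != 0.
    apply/eqP => /colP/(_ ord0); rewrite blade_vec_hub mxE => /eqP.
    by rewrite oppr_eq0 mulf_eq0 invr_eq0 !pnatr_eq0.
  rewrite -[_ *+ n.+1]mulr_natr divfK ?pnatr_eq0 // subrr => /(_ erefl).
  by rewrite mulrC ltr_pdivrMr //; lra.
Qed.

End Average.
End WindmillLaplacian.

(** * Independent uniform samples *)

(** Choose the [m] positions with value [ord0]; each other position keeps two possible values. *)
Lemma card_count_eq (t m : nat) :
  #|[set g : {ffun 'I_t -> 'I_3} | #|[pred l | g l == ord0]| == m]%SET| =
  ('C(t, m) * 2 ^ (t - m))%N.
Proof.
pose Z (g : {ffun 'I_t -> 'I_3}) := [set l | g l == ord0]%SET.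
have cardZ (g : {ffun 'I_t -> 'I_3}) : #|[pred l | g l == ord0]| = #|Z g| by rewrite cardsE.
rewrite -sum1_card (partition_big Z (fun A => #|A| == m)) /=; last first.
  by move=> g; rewrite inE cardZ.
have -> : 'C(t, m) = #|[set A : {set 'I_t} | #|A| == m]%SET|.
  by rewrite card_draws card_ord.
rewrite -sum_nat_cond_const.
apply: eq_bigr => A /eqP Am.
pose F (l : 'I_t) : pred 'I_3 := if l \in A then pred1 ord0 else predC1 ord0.
transitivity #|(family F : pred {ffun 'I_t -> 'I_3})|.
  rewrite -sum1_card; apply: eq_bigl => g; rewrite inE cardZ.
  apply/andP/familyP => [[_ /eqP ZA] l|gF].
    by rewrite /F -ZA inE; case: eqP => [->|/eqP]; rewrite !inE.
  have ZA : Z g = A.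
    apply/setP => l; rewrite inE; have := gF l; rewrite /F.
    by case: ifP => _; rewrite !inE; case: eqP.
  by rewrite ZA Am !eqxx.
rewrite card_family foldrE big_map big_enum /=.
transitivity (\prod_(l < t) (if l \in ~: A then 2 else 1))%N.
  apply: eq_bigr => l _; rewrite /F inE; case: ifP => _ /=; first by rewrite card1.
  by have := cardC1 (ord0 : 'I_3); rewrite card_ord.
by rewrite -big_mkcond prod_nat_const cardsCs finset.setCK Am card_ord.
Qed.

Lemma card_count_lt (t m : nat) :
  (#|[set g : {ffun 'I_t -> 'I_3} | (#|[pred l | g l == ord0]| < m)%N]%SET| <=
  3 ^ t - 'C(t, m) * 2 ^ (t - m))%N.
Proof.
rewrite -card_count_eq leq_subRL; last first.
  by apply: leq_trans (max_card _) _; rewrite card_ffun !card_ord.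
rewrite addnC -cardsUI; apply: leq_trans (_ : _ <= 3 ^ t + 0)%N _; last by rewrite addn0.
apply: leq_add; first by apply: leq_trans (max_card _) _; rewrite card_ffun !card_ord.
rewrite leqn0 cards_eq0; apply/eqP/setP => g; rewrite !inE.
by case: eqP => [->|]; rewrite ?ltnn ?andbF.
Qed.

(** Reading the table [H] by blades instead of by trees turns the condition into one separate
    condition per blade, so the count is at most a product. *)
Lemma card_all_count_lt (k t m : nat) :
  (#|[set H : {ffun 'I_t -> {ffun 'I_k -> 'I_3}} |
      [forall i, #|[pred l | H l i == ord0]| < m]]%SET| <=
  (3 ^ t - 'C(t, m) * 2 ^ (t - m)) ^ k)%N.
Proof.
pose swap (H : {ffun 'I_t -> {ffun 'I_k -> 'I_3}}) := [ffun i => [ffun l => H l i]].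
have swap_inj : injective swap.
  move=> H H' /ffunP HH'; apply/ffunP => l; apply/ffunP => i.
  by have /ffunP/(_ l) := HH' i; rewrite !ffunE.
rewrite -(card_imset _ swap_inj).
set S := [set g : {ffun 'I_t -> 'I_3} | (#|[pred l | g l == ord0]| < m)%N]%SET.
apply: (@leq_trans #|(ffun_on (mem S) : pred {ffun 'I_k -> {ffun 'I_t -> 'I_3}})|).
  apply/subset_leq_card/fintype.subsetP => _ /imsetP[H HP ->].
  apply/ffun_onP => i; rewrite inE.
  move: HP; rewrite inE => /forallP/(_ i).
  by congr (_ < _)%N; apply: eq_card => l; rewrite !inE !ffunE.
rewrite card_ffun_on card_ord; have [->//|k0] := posnP k.
by rewrite leq_exp2r // card_count_lt.
Qed.

Section IndependentUniform.
Context {R : realType} {d : measure_display} {Omega : measurableType d}.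
Variable P : probability Omega R.
Variables (X : finType) (S : {set X}) (t : nat) (T : 'I_t -> Omega -> X).
Hypotheses (Tm : forall l, finite_rv (T l))
  (Tunif : forall l x, P (T l @^-1` [set x]) = ((x \in S)%:R / #|S|%:R)%:E)
  (Tind : mutually_independent P T).

(** The atoms of the joint law; independence over the full index set gives their probabilities. *)
Let cell (g : {ffun 'I_t -> X}) : set Omega := [set w | [ffun l => T l w] = g].

Let cellE g : cell g = \bigcap_(l in [set` [set: 'I_t]%SET]) (T l @^-1` [set g l]).
Proof.
apply/seteqP; split=> w /=.
  by move=> wg l _ /=; rewrite -wg ffunE.
by move=> wg; apply/ffunP => l; rewrite ffunE; apply: wg; rewrite /= inE.
Qed.

Let measurable_cell g : measurable (cell g).
Proof.
rewrite cellE; apply: fin_bigcap_measurable => [|l _]; last exact: Tm.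
exact: finite_finset.
Qed.

Let prob_cell g : P (cell g) = ((g \in ffun_on (mem S))%:R / #|S|%:R ^+ t)%:E.
Proof.
rewrite cellE (Tind _ (fun l => [set g l])); under eq_bigr do rewrite Tunif.
rewrite prodEFin; congr (_%:E).
rewrite prodf_div prodr_const cardsT card_ord; congr (_ / _).
have [gS|/ffun_onP gS] := boolP (g \in ffun_on (mem S)).
  by rewrite big1 // => l _; have /ffun_onP/(_ l) glS := gS; rewrite (glS : g l \in S).
have [l gl] : exists l, g l \notin S.
  apply/existsP; rewrite -[[exists _, _]]negbK negb_exists; apply/negP => /forallP H.
  by apply: gS => l; rewrite -[_ \in _]negbK; exact: H.
by rewrite (bigD1 l) ?inE //= (negPf gl) mul0r.
Qed.

Let eventE (B : {set {ffun 'I_t -> X}}) :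
  [set w | [ffun l => T l w] \in B] = \bigcup_(g in [set` B]) cell g.
Proof.
by apply/seteqP; split=> w /=; [move=> wB; exists [ffun l => T l w] | case=> g gB ->].
Qed.

(** Each tuple from [S] has probability [#|S|%:R ^- t] and any other has probability 0, so events
    about the samples reduce to counting. *)
Lemma prob_joint (B : {set {ffun 'I_t -> X}}) :
  P [set w | [ffun l => T l w] \in B] =
  (#|[set g in ffun_on (mem S) | g \in B]%SET|%:R / #|S|%:R ^+ t)%:E.
Proof.
rewrite eventE; transitivity (\sum_(g in B) P (cell g))%E.
  rewrite measure_fin_bigcup //; last by move=> g g' _ _ [w []] /= <- <-.
  by apply/esym/bigfs => [|g _]; rewrite ?index_enum_uniq ?mem_index_enum.
under eq_bigr do rewrite prob_cell.
rewrite sumEFin -mulr_suml; congr (_ / _)%:E.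
rewrite -sum1_card natr_sum [RHS]big_mkcond [LHS]big_mkcond; apply: eq_bigr => g _.
by rewrite inE; do 2?case: (_ \in _).
Qed.

End IndependentUniform.

(** * From the tail bound in one blade to all blades *)

Theorem theorem1p8 (R : realType) (n : nat) (hn : 2 ^+ 100 <= n%:R :> R) :
  exists G : sgraph n,
    rel_connected (adj G) /\
    forall eps : R, 5 * n%:R `^ (- (1 / 10)) < eps -> eps < 1 / 2 ->
    forall t : nat, t%:Z = Num.floor (5 / 100 * eps ^- 2 * log2 n%:R) ->
    forall (d : measure_display) (Omega : measurableType d)
      (P : probability Omega R) (T : 'I_t -> Omega -> {set 'I_n * 'I_n}),
    (forall i, uniform_spanning_tree P G (T i)) ->
    mutually_independent P T ->
    let avg (w : Omega) : 'M[R]_n :=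
      t%:R^-1 *: \sum_(i < t) tree_laplacian R G (T i w) in
    ((1 - expR (- (n%:R `^ (39 / 100))))%:E <=
      P [set w | ~ lap_lt ((1 - eps) *: laplacian R G) (avg w) /\
                 ~ lap_lt (avg w) ((1 + eps) *: laplacian R G)])%E.
Proof.
(* From here on there are [n.+1] vertices, hence [n./2] blades. *)
case: n hn => [|n] hn.
  by move: hn; rewrite leNgt exprn_gt0.
exists (windmill n); split; first exact: windmill_connected.
move=> eps eps_gt eps_lt t tE d Omega P T Tunif Tind; cbv zeta.
have [t0 [m [mt m_ge p_le]]] := binomial_tail_ge hn eps_gt eps_lt tE.
pose X := {set 'I_n.+1 * 'I_n.+1}.
pose avg_of (g : {ffun 'I_t -> X}) : 'M[R]_n.+1 :=
  t%:R^-1 *: \sum_(l < t) tree_laplacian R (windmill n) (g l).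
pose bad_approx (g : {ffun 'I_t -> X}) :=
  ~ lap_lt ((1 - eps) *: laplacian R (windmill n)) (avg_of g) /\
  ~ lap_lt (avg_of g) ((1 + eps) *: laplacian R (windmill n)).
pose B : {set {ffun 'I_t -> X}} := [set g | `[< bad_approx g >]]%SET.
set S := spanning_trees (windmill n).
rewrite [X in P X](_ : _ = [set w | [ffun l => T l w] \in B]); last first.
  have avgE w : avg_of [ffun l => T l w] =
      t%:R^-1 *: \sum_(l < t) tree_laplacian R (windmill n) (T l w).
    by congr (_ *: _); apply: eq_bigr => l _; rewrite ffunE.
  apply/seteqP; split=> w /=; rewrite inE -avgE; first by move=> w_bad; apply/asboolP.
  by move/asboolP.
rewrite (prob_joint (S := S)) //; [|by move=> l; case: (Tunif l)..].
rewrite lee_fin; set A := [set g in _ | _]%SET.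
have cardS : #|S| = (3 ^ n./2)%N := card_spanning_trees_windmill n.
pose C := ('C(t, m) * 2 ^ (t - m))%N.
(* A tuple of spanning trees outside [A] has, in every blade, fewer than [m] trees that drop the rim
   edge; [card_all_count_lt] bounds the number of such tuples. *)
have cardA : (3 ^ (n./2 * t) <= #|A| + (3 ^ t - C) ^ n./2)%N.
  apply: leq_trans (leq_add (leqnn _) (card_all_count_lt n./2 t m)).
  pose Bad := [set H : {ffun 'I_t -> {ffun 'I_n./2 -> 'I_3}} |
    [forall i, (#|[pred l | H l i == ord0]| < m)%N]]%SET.
  have : ((ffun_on (mem S) : pred {ffun 'I_t -> X}) \subset
      A :|: [set [ffun l => blade_tree (H l)] |
        H : {ffun 'I_t -> {ffun 'I_n./2 -> 'I_3}} in Bad])%SET.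
    apply/fintype.subsetP => g /ffun_onP gS.
    have /choice[H gE] l : exists f, g l = blade_tree f.
      by have := gS l; rewrite /S spanning_trees_windmill => /imsetP[f _ ->]; exists f.
    rewrite finset.in_setU; have [gB|gB] := boolP (g \in B).
      by rewrite inE gB andbT; apply/orP; left; apply/ffun_onP.
    apply/orP; right; apply/imsetP; exists [ffun l => H l]; last first.
      by apply/ffunP => l; rewrite !ffunE.
    rewrite inE; apply/forallP => i; rewrite ltnNge; apply: contra gB => m_le.
    rewrite inE; apply/asboolP; rewrite /bad_approx /avg_of.
    under eq_bigr do rewrite gE.
    apply: (avg_not_approx (F := H) (i := i)) => //; apply: le_trans m_ge _.
    rewrite ler_nat; apply: leq_trans m_le _; apply: eq_leq.
    by apply: eq_card => l; rewrite !inE ffunE.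
  move=> /subset_leq_card; rewrite card_ffun_on card_ord cardS -expnM => /leq_trans; apply.
  by apply: leq_trans (leq_card_setU _ _) _; rewrite leq_add2l leq_imset_card.
have C3 : (C <= 3 ^ t)%N.
  rewrite /C -card_count_eq; apply: leq_trans (max_card _) _.
  by rewrite card_ffun !card_ord.
have t3 : 0 < 3 ^+ t :> R by rewrite exprn_gt0.
have bad_le : ((3 ^ t - C)%:R : R) <= 3 ^+ t * (1 - n.+1%:R `^ (- (59 / 100))).
  by rewrite natrB // natrX; move: p_le; rewrite -/C; lra.
(* Among all [3 ^ (n./2 * t)] tuples, the exceptional fraction is at most a power with exponent the
   number of blades. *)
have bad_expn_le : ((3 ^ t - C)%:R : R) ^+ n./2 <=
    3 ^+ (n./2 * t) * expR (- (n.+1%:R `^ (39 / 100))).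
  apply: le_trans (_ : (3 ^+ t * (1 - n.+1%:R `^ (- (59 / 100)))) ^+ n./2 <= _).
    by rewrite lerXn2r ?nnegrE //; apply: le_trans bad_le.
  rewrite exprMn -exprM mulnC ler_pM2l ?exprn_gt0 //.
  by apply: onem_expn_le => //; lia.
rewrite cardS natrX -exprM ler_pdivlMr ?exprn_gt0 //.
move: cardA; rewrite -(ler_nat R) natrD !natrX; lra.
Qed.
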